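(* Consider the reduced networked SVIRS system below on a connected weighted undirected graph, with nonnegative parameters satisfying $N>0$, $0<r<1$, $\mu>0$, $\beta>0$, $0\le p\le1$, $0\le\sigma\le1$, $0<\epsilon\le1$, and with $\eta=0$. If $\mathcal R_0>1$, then the endemic equilibrium $\mathbf E=(S_*,V_*,I_* )$ (constant over all nodes, with $S_*,V_*,I_*>0$) is globally asymptotically stable: for every solution with $S(x,0),V(x,0),I(x,0)>0$ at every node $x$, $\lim_{t\to\infty}(S,V,I)(x,t)=(S_*,V_*,I_* )$ uniformly in $x\in\mathcal V$.
   Context: Let $G=\langle \mathcal V,\mathcal E,\mathcal W\rangle$ be a connected weighted undirected graph without self-loops, $|\mathcal V|=n$, with weights $w(x,y)=w(y,x)>0$ for adjacent nodes $x\sim y$. For $F:\mathcal V\to\mathbb R$ define $\Delta F(x)=\sum_{y\in\mathcal V,\,y\sim x} w(x,y)\,[F(y)-F(x)]$. The reduced SVIRS model (obtained from an SVIRS model with total population $S+V+I+R=N$ at each node by substituting $R=N-S-V-I$) is, for $(x,t)\in\mathcal V\times[0,\infty)$, $\frac{dS}{dt}-\epsilon\Delta S=\mu(1-r)N-(\mu+p)S-\beta SI+\xi V+\eta(N-S-V-I)$, $\frac{dV}{dt}-\epsilon\Delta V=\mu rN+pS-\beta\sigma VI-(\mu+\xi)V$, $\frac{dI}{dt}-\epsilon\Delta I=\beta SI+\beta\sigma VI-(\mu+\gamma)I$. The endemic equilibrium $(S_*,V_*,I_* )$ is the constant positive solution of $0=\mu(1-r)N-(\mu+p)S-\beta SI+\xi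 V+\eta(N-S-V-I)$, $0=\mu rN+pS-\beta\sigma VI-(\mu+\xi)V$, $0=\beta S+\beta\sigma V-(\mu+\gamma)$. The basic reproduction number is $\mathcal R_0=\dfrac{\beta\big((\xi+(1-r)\mu)+\sigma(p+\mu r)\big)N}{(\gamma+\mu)(\mu+p+\xi)}$. *)

(* Defs.v *)
From mathcomp Require Import all_boot all_order all_algebra.
From mathcomp Require Import all_classical all_reals all_analysis.
Set Implicit Arguments. Unset Strict Implicit. Unset Printing Implicit Defensive.
Import Order.TTheory GRing.Theory Num.Theory.
Import numFieldNormedType.Exports.
Local Open Scope ring_scope.
Local Open Scope classical_set_scope.

Definition weighted_graph (R : realType) (T : finType) (adj : rel T) (w : T -> T -> R) : Prop :=
  [/\ symmetric adj, irreflexive adj,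
      (forall x y, w x y = w y x),
      (forall x y, adj x y -> 0 < w x y) &
      (forall x y, connect adj x y)].

Definition laplacian (R : realType) (T : finType) (adj : rel T) (w : T -> T -> R)
  (F : T -> R) (x : T) : R :=
  \sum_(y | adj x y) w x y * (F y - F x).

Definition SVIRS_solution (R : realType) (T : finType) (adj : rel T) (w : T -> T -> R)
  (N r mu p beta sigma xi eta gamma eps : R) (S V I : T -> R -> R) : Prop :=
  (forall x, S x t @[t --> 0^'+] --> S x 0) /\
  (forall x, V x t @[t --> 0^'+] --> V x 0) /\
  (forall x, I x t @[t --> 0^'+] --> I x 0) /\
  forall x t, 0 < t ->
    [/\ derivable (S x) t 1, derivable (V x) t 1 & derivable (I x) t 1] /\
    [/\ derive1 (S x) t - eps * laplacian adj w (S ^~ t) x =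
          mu * (1 - r) * N - (mu + p) * S x t - beta * S x t * I x t + xi * V x t
          + eta * (N - S x t - V x t - I x t),
        derive1 (V x) t - eps * laplacian adj w (V ^~ t) x =
          mu * r * N + p * S x t - beta * sigma * V x t * I x t - (mu + xi) * V x t &
        derive1 (I x) t - eps * laplacian adj w (I ^~ t) x =
          beta * S x t * I x t + beta * sigma * V x t * I x t - (mu + gamma) * I x t].

Definition endemic_equilibrium (R : realType)
  (N r mu p beta sigma xi eta gamma : R) (Ss Vs Is : R) : Prop :=
  [/\ 0 < Ss, 0 < Vs & 0 < Is] /\
  [/\ 0 = mu * (1 - r) * N - (mu + p) * Ss - beta * Ss * Is + xi * Vs
          + eta * (N - Ss - Vs - Is),
      0 = mu * r * N + p * Ss - beta * sigma * Vs * Is - (mu + xi) * Vs &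
      0 = beta * Ss + beta * sigma * Vs - (mu + gamma)].

Definition R0 (R : realType) (N r mu p beta sigma xi gamma : R) : R :=
  beta * ((xi + (1 - r) * mu) + sigma * (p + mu * r)) * N / ((gamma + mu) * (mu + p + xi)).

Definition unif_cvg (R : realType) (T : finType) (F : T -> R -> R) (c : R) : Prop :=
  forall e : R, 0 < e -> exists t0 : R, forall t, t0 <= t -> forall x, `|F x t - c| < e.

(* Main.v *)
(* The Volterra function W = sum_x (S - Ss ln S) + (V - Vs ln V) + (I - Is ln I) is a
   Lyapunov function.  The diffusion contributes a nonpositive term to W' by a
   discrete Green identity, and by AM-GM the reaction contributes at most
   - c ((S - Ss)^2 + (V - Vs)^2), the cross terms due to vaccination p and waning xi
   being absorbed by the dissipative ones.  After a small time t0 > 0 the solution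
   stays positive and the total population stays bounded, so all derivatives are
   bounded; a Barbalat-type argument then gives S -> Ss and V -> Vs uniformly.
   Finally I enters the S-equation through beta S (Is - I), so a persistent gap
   between I and Is would drive S away from Ss: hence I -> Is as well. *)

Require Import Defs.
From mathcomp Require Import all_boot all_order all_algebra.
From mathcomp Require Import all_classical all_reals all_analysis.
From mathcomp Require Import ring lra.
Set Implicit Arguments. Unset Strict Implicit. Unset Printing Implicit Defensive.
Import Order.TTheory GRing.Theory Num.Theory.
Import numFieldNormedType.Exports.
Local Open Scope ring_scope.
Local Open Scope classical_set_scope.

Section RealCalculus.
Variable R : realType.
Implicit Types (f df : R -> R) (a b t : R).

Lemma derive_le0_nonincr f df a b : a <= b ->
  (forall t, a <= t <= b -> is_derive t 1 f (df t)) ->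
  (forall t, a < t < b -> df t <= 0) -> f b <= f a.
Proof.
move=> ab fD df_le0.
have fDo t : t \in `]a, b[%R -> is_derive t 1 f (df t).
  by rewrite in_itv /= => /andP[a_lt_t t_lt_b]; apply: fD; rewrite !ltW.
have ab_in : a \in `[a, b]%R /\ b \in `[a, b]%R by split; rewrite in_itv /= lexx ab.
apply: (ler0_derive1_le_cc _ _ _ ab_in.2 ab_in.1 ab).
- by move=> t /fDo [].
- move=> t tab; have fDt := fDo t tab; rewrite derive1E derive_val.
  by apply: df_le0; rewrite in_itv /= in tab.
- apply: continuous_in_subspaceT => t; rewrite inE /= in_itv /= => tab.
  by have [fd _] := fD t tab; exact/differentiable_continuous/derivable1_diffP.
Qed.

Lemma derive_ub f df (K a b : R) : a <= b ->
  (forall t, a <= t <= b -> is_derive t 1 f (df t)) ->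
  (forall t, a < t < b -> df t <= K) -> f b - f a <= K * (b - a).
Proof.
move=> ab fD dfK.
suff : f b - K * b <= f a - K * a by lra.
apply: (@derive_le0_nonincr (fun s => f s - K * s) (fun s => df s - K)) => //.
  move=> t /fD tD; apply: is_derive_eq (is_deriveB tD (is_deriveZ K (is_derive_id t 1))) _.
  by rewrite /GRing.scale /= mulr1.
by move=> t /dfK; lra.
Qed.

Lemma derive_lb f df (K a b : R) : a <= b ->
  (forall t, a <= t <= b -> is_derive t 1 f (df t)) ->
  (forall t, a < t < b -> K <= df t) -> K * (b - a) <= f b - f a.
Proof.
move=> ab fD Kdf.
have := @derive_ub (fun s => - f s) (fun s => - df s) (- K) a b ab.
have NfD t : a <= t <= b -> is_derive t 1 (fun s => - f s) (- df t).
  by move/fD/is_deriveN.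
have NKdf t : a < t < b -> - df t <= - K by move/Kdf; lra.
by move=> /(_ NfD NKdf); lra.
Qed.

Lemma slow_drop f df (K a t h : R) : 0 <= K -> a <= t ->
  (forall u, a <= u -> is_derive u 1 f (df u)) -> (forall u, a <= u -> - K <= df u) ->
  forall u, t <= u <= t + h -> f t - K * h <= f u.
Proof.
move=> K0 a_le_t fD dfK u /andP[tu uth].
have := @derive_lb f df (- K) t u tu.
have fD' x : t <= x <= u -> is_derive x 1 f (df x).
  by move=> /andP[tx _]; apply: fD; exact: le_trans a_le_t tx.
have dfK' x : t < x < u -> - K <= df x.
  by move=> /andP[tx _]; apply: dfK; exact: le_trans a_le_t (ltW tx).
move=> /(_ fD' dfK').
have : K * (u - t) <= K * h by apply: ler_wpM2l => //; lra.
lra.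
Qed.

Lemma gronwall f df (k a b : R) : a <= b ->
  (forall t, a <= t <= b -> is_derive t 1 f (df t)) ->
  (forall t, a < t < b -> - k * f t <= df t) ->
  expR (k * a) * f a <= expR (k * b) * f b.
Proof.
move=> ab fD kdf.
have ekD t : is_derive t 1 (fun s => expR (k * s)) (k * expR (k * t)).
  have kD : is_derive t 1 (fun s => k * s) k.
    by apply: is_derive_eq (is_deriveZ k (is_derive_id t 1)) _; rewrite /GRing.scale /= mulr1.
  by apply: is_derive_eq (is_derive1_comp (is_derive_expR (k * t)) kD) _; rewrite mulrC.
suff : - (expR (k * b) * f b) - - (expR (k * a) * f a) <= 0 * (b - a) by lra.
apply: (@derive_ub (fun t => - (expR (k * t) * f t))
                   (fun t => - (expR (k * t) * (df t + k * f t)))) => //.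
  move=> t /fD fDt; apply: is_deriveN; apply: is_derive_eq (is_deriveM (ekD t) fDt) _.
  by rewrite /GRing.scale /=; ring.
move=> t /kdf h; rewrite oppr_le0; apply: mulr_ge0; [exact: expR_ge0 | lra].
Qed.

Lemma is_derive_sumT (I : finType) (h : I -> R -> R) (dh : I -> R) t :
  (forall i, is_derive t 1 (h i) (dh i)) ->
  is_derive t 1 (fun s => \sum_i h i s) (\sum_i dh i).
Proof.
move=> hD; have -> : (fun s => \sum_i h i s) = \sum_i h i.
  by apply/funext => s; rewrite fct_sumE.
by elim/big_ind2 : _ => // *; [exact: is_derive_cst | exact: is_deriveD].
Qed.

Lemma is_derive_sqrB f (df c t : R) : is_derive t 1 f df ->
  is_derive t 1 (fun s => (f s - c) ^+ 2) (2 * (f t - c) * df).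
Proof.
move=> fD; have fcD : is_derive t 1 (fun s => f s - c) df.
  by apply: is_derive_eq (is_deriveB fD (is_derive_cst c t 1)) _; rewrite subr0.
apply: is_derive_eq (is_deriveM fcD fcD) _; rewrite /GRing.scale /=; ring.
Qed.

Definition volterra (c u : R) := u - c * ln u.

Lemma volterra_ge (c u : R) : 0 < c -> 0 < u -> volterra c c <= volterra c u.
Proof.
move=> c0 u0; have uc0 := divr_gt0 u0 c0.
have : ln (u / c) <= u / c - 1.
  by have := @le_ln1Dx _ (u / c - 1); rewrite addrCA subrr addr0; apply; lra.
rewrite ln_div ?posrE // => /(ler_wpM2l (ltW c0)).
rewrite !mulrBr mulrCA divff ?gt_eqF // mulr1 /volterra; lra.
Qed.

Lemma is_derive_volterra f (df c t : R) : 0 < f t -> is_derive t 1 f df ->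
  is_derive t 1 (fun s => volterra c (f s)) ((1 - c / f t) * df).
Proof.
move=> ft0 fD; have lnD := is_derive1_comp (is_derive1_ln ft0) fD.
apply: is_derive_eq (is_deriveB fD (is_deriveZ c lnD)) _.
rewrite /GRing.scale /=; field; exact: lt0r_neq0.
Qed.

Lemma real_induction (P : R -> Prop) a :
  P a ->
  (forall b, a < b -> (forall s, a < s < b -> P s) -> P b) ->
  (forall t, a <= t -> P t -> \forall s \near t, P s) ->
  forall t, a <= t -> P t.
Proof.
move=> Pa Pclosed Popen t a_le_t; apply: contrapT => nPt.
set B := [set s | a <= s /\ ~ P s].
have lbB : lbound B a by move=> s [].
have infB : has_inf B by split; [exists t | exists a].
have a_le_inf : a <= inf B by apply: lb_le_inf => //; exists t.
have P_below s : a <= s < inf B -> P s.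
  move=> /andP[a_le_s s_lt]; apply: contrapT => nPs.
  by move: s_lt; rewrite ltNge ge_inf //; case: infB.
have Pinf : P (inf B).
  have [<- // | a_ne] := eqVneq a (inf B).
  apply: Pclosed; first by rewrite lt_neqAle a_ne.
  by move=> s /andP[a_lt_s s_lt]; apply: P_below; rewrite s_lt ltW.
have /nbhs_ballP[e e0 Pball] := Popen _ a_le_inf Pinf.
have [b Bb b_lt] := inf_adherent e0 infB.
have inf_le_b : inf B <= b by apply: ge_inf => //; case: infB.
case: Bb => _; apply; apply: Pball.
by rewrite /ball /= distrC ger0_norm ?subr_ge0 // ltrBlDl.
Qed.

Lemma nonincr_bounded_flat (W : R -> R) a m :
  (forall s t, a <= s -> s <= t -> W t <= W s) ->
  (forall t, a <= t -> m <= W t) ->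
  forall d, 0 < d -> exists2 T, a <= T & forall t, T <= t -> W T - W t < d.
Proof.
move=> Wnonincr Wm d d0.
set B := [set W t | t in [set t | a <= t]].
have infB : has_inf B.
  split; first by exists (W a), a => /=.
  by exists m => _ [t a_le_t <-]; exact: Wm.
have [_ [T aT <-] WT_lt] := inf_adherent d0 infB.
exists T => // t Tt.
have : inf B <= W t by apply: ge_inf; [case: infB | exists t => //; exact: le_trans Tt].
lra.
Qed.

(* W is eventually flat; but whenever g >= e, it stays >= e/2 for a time e/(2L)
   since g' >= -L, and W then drops by a fixed amount. *)
Lemma dissipation_cvg (W dW g dg : R -> R) (a c L m : R) : 0 < c -> 0 < L ->
  (forall t, a <= t -> is_derive t 1 W (dW t)) ->
  (forall t, a <= t -> is_derive t 1 g (dg t)) ->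
  (forall t, a <= t -> 0 <= g t) ->
  (forall t, a <= t -> dW t <= - c * g t) ->
  (forall t, a <= t -> - L <= dg t) ->
  (forall t, a <= t -> m <= W t) ->
  forall e, 0 < e -> exists T, forall t, T <= t -> g t < e.
Proof.
move=> c0 L0 WD gD g_ge0 dW_le dg_ge Wm e e0.
set h := e / (2 * L).
have h0 : 0 < h by rewrite divr_gt0 ?mulr_gt0.
have Lh : L * h = e / 2 by rewrite /h; field; exact: lt0r_neq0.
have dW_le0 t : a <= t -> dW t <= 0.
  move=> a_le_t; apply: le_trans (dW_le t a_le_t) _.
  by rewrite mulNr oppr_le0; apply: mulr_ge0; [exact: ltW | exact: g_ge0].
have Wnonincr s t : a <= s -> s <= t -> W t <= W s.
  move=> a_le_s st; apply: (derive_le0_nonincr st).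
    by move=> u /andP[su _]; apply: WD; exact: le_trans su.
  by move=> u /andP[su _]; apply: dW_le0; exact: le_trans (ltW su).
set d := c * (e / 2) * h.
have d0 : 0 < d by rewrite /d; do 2 apply: mulr_gt0 => //; exact: divr_gt0.
have [T aT flat] := nonincr_bounded_flat Wnonincr Wm d0.
exists T => t Tt; rewrite ltNge; apply/negP => e_le_g.
have a_le_t := le_trans aT Tt.
have g_half u : t <= u <= t + h -> e / 2 <= g u.
  by move/(slow_drop (ltW L0) a_le_t gD dg_ge); lra.
have : W (t + h) - W t <= - (c * (e / 2)) * (t + h - t).
  apply: derive_ub; first by rewrite lerDl ltW.
    by move=> u /andP[tu _]; apply: WD; exact: le_trans a_le_t tu.
  move=> u /andP[tu uth]; have a_le_u := le_trans a_le_t (ltW tu).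
  apply: le_trans (dW_le u a_le_u) _.
  rewrite !mulNr lerN2; apply: ler_wpM2l; first exact: ltW.
  by apply: g_half; rewrite !ltW.
have Tth : T <= t + h by apply: le_trans Tt _; rewrite lerDl ltW.
have := flat _ Tth; have := Wnonincr T t aT Tt.
rewrite /d; lra.
Qed.

(* If i reached i0 + e, it would stay above i0 + e/2 for a time h, during which s
   would decrease by more than 2 rho, leaving the rho-neighbourhood of s0. *)
Lemma forcing_lt (s i ds di a : R -> R) (s0 i0 T a0 K e h rho : R) :
  0 < a0 -> 0 <= K -> 0 < e -> 0 < h ->
  K * h <= e / 2 -> rho * (h + 2) <= a0 * (e / 2) * h ->
  (forall t, T <= t -> is_derive t 1 s (ds t)) ->
  (forall t, T <= t -> is_derive t 1 i (di t)) ->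
  (forall t, T <= t -> - K <= di t) ->
  (forall t, T <= t -> a0 <= a t) ->
  (forall t, T <= t -> `|s t - s0| < rho) ->
  (forall t, T <= t -> ds t - a t * (i0 - i t) <= rho) ->
  forall t, T <= t -> i t < i0 + e.
Proof.
move=> a00 K0 e0 h0 Kh rho_le sD iD di_ge a_ge s_near ds_le t Tt.
rewrite ltNge; apply/negP => i_ge.
have i_high u : t <= u <= t + h -> i0 + e / 2 <= i u.
  by move/(slow_drop K0 Tt iD di_ge); lra.
have : s (t + h) - s t <= (rho - a0 * (e / 2)) * (t + h - t).
  apply: derive_ub; first by rewrite lerDl ltW.
    by move=> u /andP[tu _]; apply: sD; exact: le_trans Tt tu.
  move=> u /andP[tu uth]; have Tu := le_trans Tt (ltW tu).
  have iu : i0 + e / 2 <= i u by apply: i_high; rewrite !ltW.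
  have : a0 * (e / 2) <= a u * (i u - i0).
    apply: ler_pM; [exact: ltW | by rewrite divr_ge0 ?ltW | exact: a_ge | lra].
  have := ds_le u Tu; lra.
have Tth : T <= t + h by apply: le_trans Tt _; rewrite lerDl ltW.
have := s_near t Tt; have := s_near _ Tth.
rewrite !ltr_norml => /andP[s1 s2] /andP[s3 s4]; lra.
Qed.

Lemma forcing_cvg (a0 K e : R) : 0 < a0 -> 0 <= K -> 0 < e ->
  exists2 rho, 0 < rho & forall (s i ds di a : R -> R) (s0 i0 T : R),
  (forall t, T <= t -> is_derive t 1 s (ds t)) ->
  (forall t, T <= t -> is_derive t 1 i (di t)) ->
  (forall t, T <= t -> `|di t| <= K) ->
  (forall t, T <= t -> a0 <= a t) ->
  (forall t, T <= t -> `|s t - s0| < rho) ->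
  (forall t, T <= t -> `|ds t - a t * (i0 - i t)| <= rho) ->
  forall t, T <= t -> `|i t - i0| < e.
Proof.
move=> a00 K0 e0.
set h := e / (2 * (K + 1)).
have h0 : 0 < h by rewrite divr_gt0 // mulr_gt0 // ltr_wpDl.
have Kh : K * h <= e / 2.
  have : (K + 1) * h = e / 2 by rewrite /h; field; rewrite gt_eqF // ltr_wpDl.
  lra.
set rho := a0 * (e / 2) * h / (h + 2).
have h20 : 0 < h + 2 by lra.
have rho0 : 0 < rho.
  rewrite /rho; apply: divr_gt0 => //; apply: mulr_gt0 => //.
  by apply: mulr_gt0 => //; apply: divr_gt0; lra.
have rho_le : rho * (h + 2) <= a0 * (e / 2) * h by rewrite /rho divfK ?gt_eqF.
exists rho => // s i ds di a s0 i0 T sD iD di_le a_ge s_near ds_le t Tt.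
have di_bnd u : T <= u -> - K <= di u <= K by move/di_le; rewrite ler_norml.
have ds_bnd u : T <= u -> - rho <= ds u - a u * (i0 - i u) <= rho.
  by move/ds_le; rewrite ler_norml.
have upper (s' i' ds' di' : R -> R) (s0' i0' : R) :
    (forall u, T <= u -> is_derive u 1 s' (ds' u)) ->
    (forall u, T <= u -> is_derive u 1 i' (di' u)) ->
    (forall u, T <= u -> - K <= di' u) ->
    (forall u, T <= u -> `|s' u - s0'| < rho) ->
    (forall u, T <= u -> ds' u - a u * (i0' - i' u) <= rho) -> i' t < i0' + e.
  move=> sD' iD' di_ge' s_near' ds_le'.
  exact: (forcing_lt a00 K0 e0 h0 Kh rho_le sD' iD' di_ge' a_ge s_near' ds_le' Tt).
rewrite ltr_norml; apply/andP; split.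
- suff : - i t < - i0 + e by lra.
  apply: (upper (fun u => - s u) (fun u => - i u) (fun u => - ds u) (fun u => - di u)
    (- s0)).
  + by move=> u /sD /is_deriveN.
  + by move=> u /iD /is_deriveN.
  + by move=> u /di_bnd; lra.
  + by move=> u /s_near; rewrite -opprB opprK addrC normrN.
  + by move=> u /ds_bnd; lra.
- suff : i t < i0 + e by lra.
  apply: (upper s i ds di s0) => // [u /di_bnd | u /ds_bnd]; lra.
Qed.

End RealCalculus.

Section Laplacian.
Variables (R : realType) (T : finType) (adj : rel T) (w : T -> T -> R).
Hypotheses (adj_sym : symmetric adj) (w_sym : forall x y, w x y = w y x)
  (w_gt0 : forall x y, adj x y -> 0 < w x y).
Implicit Types (F : T -> R) (x : T).

Let sum_adj_swap (g : T -> T -> R) :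
  \sum_x \sum_(y | adj x y) g x y = \sum_x \sum_(y | adj x y) g y x.
Proof.
under eq_bigr do rewrite big_mkcond /=.
rewrite exchange_big /=; apply: eq_bigr => y _.
by rewrite [RHS]big_mkcond /=; apply: eq_bigr => x _; rewrite adj_sym.
Qed.

Lemma laplacian_sum0 F : \sum_x laplacian adj w F x = 0.
Proof.
rewrite /laplacian; set H := \sum_x _.
suff : H = - H by lra.
rewrite {1}/H sum_adj_swap /H -sumrN; apply: eq_bigr => x _.
by rewrite -sumrN; apply: eq_bigr => y _; rewrite w_sym; lra.
Qed.

(* Discrete Green identity: symmetrising the double sum pairs the terms of
   [x] and [y] into [- c w(x,y) (F y - F x)^2 / (F x F y)]. *)
Lemma laplacian_volterra_le0 F (c : R) : 0 <= c -> (forall x, 0 < F x) ->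
  \sum_x (1 - c / F x) * laplacian adj w F x <= 0.
Proof.
move=> c0 F_gt0; rewrite /laplacian.
under eq_bigr do rewrite big_distrr /=.
set H := \sum_x _.
have HE : H = \sum_x \sum_(y | adj x y) (1 - c / F y) * (w x y * (F x - F y)).
  by rewrite {1}/H sum_adj_swap; apply: eq_bigr => x _; apply: eq_bigr => y _; rewrite w_sym.
suff : H + H <= 0 by lra.
rewrite {2}HE /H -big_split /=; apply: sumr_le0 => x _.
rewrite -big_split /=; apply: sumr_le0 => y xy.
have wxy := w_gt0 xy; have Fx := F_gt0 x; have Fy := F_gt0 y.
have -> : (1 - c / F x) * (w x y * (F y - F x)) + (1 - c / F y) * (w x y * (F x - F y))
    = - (c * w x y * ((F y - F x) ^+ 2 / (F x * F y))).
  by field; rewrite !gt_eqF.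
rewrite oppr_le0; apply: mulr_ge0; first by apply: mulr_ge0 => //; exact: ltW.
by apply: divr_ge0; [exact: sqr_ge0 | exact/ltW/mulr_gt0].
Qed.

Definition total_weight := \sum_x \sum_(y | adj x y) w x y.

Let adj_weight_le x : \sum_(y | adj x y) w x y <= total_weight.
Proof.
rewrite /total_weight [X in _ <= X](bigD1 x) //= lerDl.
by apply: sumr_ge0 => z _; apply: sumr_ge0 => y zy; exact/ltW/w_gt0.
Qed.

Lemma total_weight_ge0 : 0 <= total_weight.
Proof. by apply: sumr_ge0 => x _; apply: sumr_ge0 => y xy; exact/ltW/w_gt0. Qed.

Lemma laplacian_ge F x : (forall y, 0 <= F y) ->
  - total_weight * F x <= laplacian adj w F x.
Proof.
move=> F_ge0; apply: le_trans (_ : \sum_(y | adj x y) w x y * (- F x) <= _).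
  rewrite -mulr_suml mulrN mulNr lerN2.
  by apply: ler_wpM2r; [exact: F_ge0 | exact: adj_weight_le].
apply: ler_sum => y xy; apply: ler_wpM2l; first exact/ltW/w_gt0.
by have := F_ge0 y; lra.
Qed.

Lemma norm_laplacian_le F x (K : R) : (forall y, `|F y - F x| <= K) ->
  `|laplacian adj w F x| <= total_weight * K.
Proof.
move=> FK; have K0 : 0 <= K by apply: le_trans (FK x); exact: normr_ge0.
apply: le_trans (ler_norm_sum _ _ _) _.
apply: le_trans (_ : \sum_(y | adj x y) w x y * K <= _).
  apply: ler_sum => y xy; rewrite normrM gtr0_norm ?w_gt0 //.
  by apply: ler_wpM2l; [exact/ltW/w_gt0 | exact: FK].
by rewrite -mulr_suml; apply: ler_wpM2r; [exact: K0 | exact: adj_weight_le].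
Qed.

End Laplacian.

Section LyapunovAlgebra.
Variable R : realFieldType.
Implicit Types x y : R.

Lemma amgm3_poly x y : 0 < x -> 0 < y -> 0 <= x ^+ 2 + y + x * y ^+ 2 - 3 * x * y.
Proof.
move=> x0 y0.
have E : 4 * (x ^+ 2 + y + x * y ^+ 2 - 3 * x * y) =
   (2 * x + y ^+ 2 - 3 * y) ^+ 2 + y * (y - 1) ^+ 2 * (4 - y) by ring.
have [y_le3|y_gt3] := lerP y 3.
  have := sqr_ge0 (2 * x + y ^+ 2 - 3 * y).
  have : 0 <= y * (y - 1) ^+ 2 * (4 - y).
    by apply: mulr_ge0; [apply: mulr_ge0; [exact: ltW | exact: sqr_ge0] | lra].
  lra.
have : 0 <= x * y * (y - 3) by apply: mulr_ge0; [apply: mulr_ge0; exact: ltW | lra].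
have := sqr_ge0 x; lra.
Qed.

Lemma amgm3 x y : 0 < x -> 0 < y -> 3 - y - 1 / x - x / y <= 0.
Proof.
move=> x0 y0.
have -> : 3 - y - 1 / x - x / y = - ((x ^+ 2 + y + x * y ^+ 2 - 3 * x * y) / (x * y)).
  by field; rewrite !gt_eqF.
by rewrite oppr_le0 divr_ge0 ?amgm3_poly // ltW // mulr_gt0.
Qed.

Lemma amgm2 x y : 0 < x -> 0 < y -> 2 - x / y - y / x <= 0.
Proof.
move=> x0 y0; have -> : 2 - x / y - y / x = - ((x - y) ^+ 2 / (x * y)).
  by field; rewrite !gt_eqF.
by rewrite oppr_le0 divr_ge0 ?sqr_ge0 // ltW // mulr_gt0.
Qed.

Lemma cross_terms_le (P Q x y : R) : 0 <= P -> 0 <= Q -> 0 < x -> 0 < y ->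
  P * ((1 - 1 / x) * (1 - x / y)) + Q * ((1 - 1 / y) * (1 - y / x))
  <= (Q - Num.min P Q) * ((x - 1) ^+ 2 / x) + (P - Num.min P Q) * ((y - 1) ^+ 2 / y).
Proof.
wlog PQ : P Q x y / P <= Q => [sym P0 Q0 x0 y0 | P0 Q0 x0 y0].
  have /orP[PQ|QP] := le_total P Q; first exact: sym.
  by rewrite [leLHS]addrC [leRHS]addrC minC; apply: sym.
have -> : Num.min P Q = P by apply/min_idPl.
rewrite subrr mul0r addr0.
set k := 2 - x / y - y / x; set g := 3 - x - 1 / y - y / x; set u := (x - 1) ^+ 2 / x.
have -> : (1 - 1 / y) * (1 - y / x) = g + u by rewrite /g /u; field; rewrite !gt_eqF.
have -> : (1 - 1 / x) * (1 - x / y) = k - (g + u) by rewrite /k /g /u; field; rewrite !gt_eqF.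
have : P * k <= 0 by rewrite mulr_ge0_le0 ?amgm2.
have : (Q - P) * g <= 0 by rewrite mulr_ge0_le0 ?amgm3 ?subr_ge0.
lra.
Qed.

Lemma min_shift (A P Q : R) : A - Q + Num.min P Q = Num.min A (A + P - Q).
Proof.
have /orP[PQ|QP] := le_total P Q.
  have -> : Num.min P Q = P by apply/min_idPl.
  have -> : Num.min A (A + P - Q) = A + P - Q by apply/min_idPr; lra.
  ring.
have -> : Num.min P Q = Q by apply/min_idPr.
have -> : Num.min A (A + P - Q) = A by apply/min_idPl; lra.
ring.
Qed.

(* The minima come from absorbing, via [cross_terms_le], the cross terms of
   vaccination (P = p Ss) and waning (Q = xi Vs) into the dissipative terms. *)
Lemma reaction_lyapunov_le (s v i Ss Vs Is mu p beta sigma xi gamma a b : R) :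
  0 < s -> 0 < v -> 0 < i -> 0 < Ss -> 0 < Vs -> 0 < Is -> 0 <= p -> 0 <= xi ->
  a = (mu + p) * Ss + beta * Ss * Is - xi * Vs ->
  b = (mu + xi) * Vs + beta * sigma * Vs * Is - p * Ss ->
  mu + gamma = beta * Ss + beta * sigma * Vs ->
  (1 - Ss / s) * (a - (mu + p) * s - beta * s * i + xi * v)
  + (1 - Vs / v) * (b + p * s - beta * sigma * v * i - (mu + xi) * v)
  + (1 - Is / i) * (beta * s * i + beta * sigma * v * i - (mu + gamma) * i)
  <= - (Num.min ((mu + beta * Is) * Ss) a * ((s - Ss) ^+ 2 / (s * Ss))
        + Num.min ((mu + beta * sigma * Is) * Vs) b * ((v - Vs) ^+ 2 / (v * Vs))).
Proof.
move=> s0 v0 i0 Ss0 Vs0 Is0 p0 xi0 aE bE gammaE.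
set A := (mu + beta * Is) * Ss; set B := (mu + beta * sigma * Is) * Vs.
set P := p * Ss; set Q := xi * Vs; set x := s / Ss; set y := v / Vs.
have x0 : 0 < x by exact: divr_gt0.
have y0 : 0 < y by exact: divr_gt0.
have -> : (s - Ss) ^+ 2 / (s * Ss) = (x - 1) ^+ 2 / x by rewrite /x; field; rewrite !gt_eqF.
have -> : (v - Vs) ^+ 2 / (v * Vs) = (y - 1) ^+ 2 / y by rewrite /y; field; rewrite !gt_eqF.
have -> : a = A + P - Q by rewrite aE /A /P /Q; ring.
have -> : b = B + Q - P by rewrite bE /B /P /Q; ring.
rewrite -!min_shift.
have -> : (1 - Ss / s) * (A + P - Q - (mu + p) * s - beta * s * i + xi * v)
  + (1 - Vs / v) * (B + Q - P + p * s - beta * sigma * v * i - (mu + xi) * v)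
  + (1 - Is / i) * (beta * s * i + beta * sigma * v * i - (mu + gamma) * i)
  = - (A * ((x - 1) ^+ 2 / x) + B * ((y - 1) ^+ 2 / y))
    + (P * ((1 - 1 / x) * (1 - x / y)) + Q * ((1 - 1 / y) * (1 - y / x))).
  by rewrite /A /B /P /Q /x /y gammaE; field; rewrite !gt_eqF.
have := cross_terms_le (mulr_ge0 p0 (ltW Ss0)) (mulr_ge0 xi0 (ltW Vs0)) x0 y0.
rewrite -/P -/Q [Num.min Q P]minC; lra.
Qed.

Lemma ler_mul_ratio (m q s ss M c : R) : 0 <= m -> 0 <= q -> 0 < s -> s <= M -> 0 < ss ->
  c <= m / (M * ss) -> c * q <= m * (q / (s * ss)).
Proof.
move=> m0 q0 s0 sM ss0 cm; have M0 := lt_le_trans s0 sM.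
apply: le_trans (ler_wpM2r q0 cm) _; rewrite mulrAC -mulrA ler_wpM2l //.
by rewrite ler_wpM2l // lef_pV2 ?posrE ?mulr_gt0 // ler_wpM2r // ltW.
Qed.

Lemma norm_reactions_le (s v i M mu p xi gamma beta sigma r N : R) :
  0 < s <= M -> 0 < v <= M -> 0 < i <= M ->
  0 <= mu -> 0 <= p -> 0 <= xi -> 0 <= gamma -> 0 <= beta ->
  0 <= sigma <= 1 -> 0 <= r <= 1 -> 0 <= N ->
  let K := mu * N + (mu + p + xi + gamma) * M + 2 * beta * M * M in
  [/\ `|mu * (1 - r) * N - (mu + p) * s - beta * s * i + xi * v| <= K,
      `|mu * r * N + p * s - beta * sigma * v * i - (mu + xi) * v| <= K &
      `|beta * s * i + beta * sigma * v * i - (mu + gamma) * i| <= K].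
Proof.
move=> /andP[s0 sM] /andP[v0 vM] /andP[i0 iM] mu0 p0 xi0 g0 b0 /andP[sg0 sg1] /andP[r0 r1]
  N0 K.
have bnd (c z : R) : 0 <= c -> 0 < z -> z <= M -> 0 <= c * z <= c * M.
  by move=> c0 z0 zM; rewrite (mulr_ge0 c0 (ltW z0)) (ler_wpM2l c0 zM).
have /andP[? ?] := bnd _ _ mu0 s0 sM; have /andP[? ?] := bnd _ _ p0 s0 sM.
have /andP[? ?] := bnd _ _ xi0 v0 vM; have /andP[? ?] := bnd _ _ mu0 v0 vM.
have /andP[? ?] := bnd _ _ mu0 i0 iM; have /andP[? ?] := bnd _ _ g0 i0 iM.
have si0 : 0 <= s * i := mulr_ge0 (ltW s0) (ltW i0).
have vi0 : 0 <= v * i := mulr_ge0 (ltW v0) (ltW i0).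
have siM : s * i <= M * M := ler_pM (ltW s0) (ltW i0) sM iM.
have sviM : sigma * (v * i) <= M * M.
  exact: le_trans (ler_piMl vi0 sg1) (ler_pM (ltW v0) (ltW i0) vM iM).
have := mulr_ge0 b0 si0; have := ler_wpM2l b0 siM.
have := mulr_ge0 b0 (mulr_ge0 sg0 vi0); have := ler_wpM2l b0 sviM.
have := mulr_ge0 mu0 (mulr_ge0 r0 N0); have := ler_wpM2l mu0 (ler_piMl N0 r1).
have r1' : 0 <= 1 - r <= 1 by apply/andP; split; lra.
have := mulr_ge0 mu0 (mulr_ge0 (andP r1').1 N0).
have := ler_wpM2l mu0 (ler_piMl N0 (andP r1').2).
by rewrite /K; split; rewrite ler_norml; apply/andP; split; lra.
Qed.

Lemma norm_lt_sqr (a e : R) : 0 < e -> a ^+ 2 < e ^+ 2 -> `|a| < e.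
Proof.
by move=> e0; rewrite -real_normK ?num_real // ltr_pXn2r ?nnegrE ?normr_ge0 ?(ltW e0).
Qed.

End LyapunovAlgebra.

Section SVIRS.
Variables (R : realType) (T : finType) (adj : rel T) (w : T -> T -> R)
  (N r mu p beta sigma xi gamma eps : R) (Ss Vs Is : R) (S V I : T -> R -> R).
Hypothesis graph : weighted_graph adj w.
Hypotheses (N_gt0 : 0 < N) (r_gt0 : 0 < r) (r_lt1 : r < 1) (mu_gt0 : 0 < mu)
  (beta_gt0 : 0 < beta) (p_ge0 : 0 <= p) (sigma_ge0 : 0 <= sigma) (sigma_le1 : sigma <= 1)
  (eps_gt0 : 0 < eps) (xi_ge0 : 0 <= xi) (gamma_ge0 : 0 <= gamma).
Hypothesis equilibrium : endemic_equilibrium N r mu p beta sigma xi 0 gamma Ss Vs Is.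
Hypothesis solution : SVIRS_solution adj w N r mu p beta sigma xi 0 gamma eps S V I.
Hypothesis init_pos : forall x, 0 < S x 0 /\ 0 < V x 0 /\ 0 < I x 0.
Implicit Types (x : T) (t : R).

Let adj_sym : symmetric adj. Proof. by case: graph. Qed.
Let w_sym : forall x y, w x y = w y x. Proof. by case: graph. Qed.
Let w_gt0 : forall x y, adj x y -> 0 < w x y. Proof. by case: graph. Qed.

Let Ss_gt0 : 0 < Ss. Proof. by case: equilibrium => -[]. Qed.
Let Vs_gt0 : 0 < Vs. Proof. by case: equilibrium => -[]. Qed.
Let Is_gt0 : 0 < Is. Proof. by case: equilibrium => -[]. Qed.
Let aE : mu * (1 - r) * N = (mu + p) * Ss + beta * Ss * Is - xi * Vs.
Proof. by case: equilibrium => _ [+ _ _]; rewrite mul0r addr0; lra. Qed.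
Let bE : mu * r * N = (mu + xi) * Vs + beta * sigma * Vs * Is - p * Ss.
Proof. by case: equilibrium => _ [_ + _]; lra. Qed.
Let gammaE : mu + gamma = beta * Ss + beta * sigma * Vs.
Proof. by case: equilibrium => _ [_ _ +]; lra. Qed.
Let a_gt0 : 0 < mu * (1 - r) * N. Proof. by rewrite !mulr_gt0 // subr_gt0. Qed.
Let b_gt0 : 0 < mu * r * N. Proof. by rewrite !mulr_gt0. Qed.

Definition fS x t :=
  mu * (1 - r) * N - (mu + p) * S x t - beta * S x t * I x t + xi * V x t.
Definition fV x t :=
  mu * r * N + p * S x t - beta * sigma * V x t * I x t - (mu + xi) * V x t.
Definition fI x t :=
  beta * S x t * I x t + beta * sigma * V x t * I x t - (mu + gamma) * I x t.
Definition dS x t := eps * laplacian adj w (S ^~ t) x + fS x t.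
Definition dV x t := eps * laplacian adj w (V ^~ t) x + fV x t.
Definition dI x t := eps * laplacian adj w (I ^~ t) x + fI x t.

Lemma is_derive_SVI x t : 0 < t ->
  [/\ is_derive t 1 (S x) (dS x t), is_derive t 1 (V x) (dV x t)
    & is_derive t 1 (I x) (dI x t)].
Proof.
case: solution => _ [_ [_ sol]] /(sol x) [[dSx dVx dIx] [eS eV eI]].
split; apply: DeriveDef => //; rewrite -derive1E.
- by rewrite /dS /fS -[LHS](subrK (eps * laplacian adj w (S^~ t) x)) eS mul0r addr0; ring.
- by rewrite /dV /fV -[LHS](subrK (eps * laplacian adj w (V^~ t) x)) eV; ring.
- by rewrite /dI /fI -[LHS](subrK (eps * laplacian adj w (I^~ t) x)) eI; ring.
Qed.

Definition positive t := forall x, 0 < S x t /\ 0 < V x t /\ 0 < I x t.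

Lemma eventually_positive (F : set_system R) {FF : Filter F} t :
  (forall x, [/\ S x s @[s --> F] --> S x t, V x s @[s --> F] --> V x t
               & I x s @[s --> F] --> I x t]) ->
  positive t -> \forall s \near F, positive s.
Proof.
move=> cvgF pos_t.
apply: (@filter_forall R T (fun x s => 0 < S x s /\ 0 < V x s /\ 0 < I x s)) => x.
have [cS cV cI] := cvgF x; have [S0 [V0 I0]] := pos_t x.
near=> s; split; [|split]; near: s.
- exact: (cvgr_gt _ cS _ S0).
- exact: (cvgr_gt _ cV _ V0).
- exact: (cvgr_gt _ cI _ I0).
Unshelve. all: by end_near.
Qed.

Lemma positive_after0 : exists2 t0, 0 < t0 & positive t0.
Proof.
case: solution => cS [cV [cI _]].
have pos : \forall t \near 0^'+, 0 < t /\ positive t.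
  near=> t; split; near: t; first exact: nbhs_right_gt.
  exact: eventually_positive.
by have [t []] := filter_ex pos; exists t.
Unshelve. all: by end_near.
Qed.

Definition population t := \sum_x (S x t + V x t + I x t).

Lemma is_derive_population t : 0 < t -> is_derive t 1 population
  (\sum_x (mu * N - mu * (S x t + V x t + I x t) - gamma * I x t)).
Proof.
move=> t_gt0.
have dsum : \sum_x (dS x t + dV x t + dI x t)
    = \sum_x (mu * N - mu * (S x t + V x t + I x t) - gamma * I x t).
  have E x : dS x t + dV x t + dI x t = eps * (laplacian adj w (S ^~ t) x
      + laplacian adj w (V ^~ t) x + laplacian adj w (I ^~ t) x)
      + (mu * N - mu * (S x t + V x t + I x t) - gamma * I x t).
    by rewrite /dS /dV /dI /fS /fV /fI; ring.
  under eq_bigr do rewrite E.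
  by rewrite big_split /= -mulr_sumr !big_split /= !laplacian_sum0 // !addr0 mulr0 add0r.
apply: is_derive_eq dsum; apply: is_derive_sumT => x.
have [dSx dVx dIx] := is_derive_SVI x t_gt0.
exact: is_deriveD (is_deriveD dSx dVx) dIx.
Qed.

Definition coefS := Num.min ((mu + beta * Is) * Ss) (mu * (1 - r) * N).
Definition coefV := Num.min ((mu + beta * sigma * Is) * Vs) (mu * r * N).

Let coefS_gt0 : 0 < coefS.
Proof.
rewrite lt_min a_gt0 andbT mulr_gt0 //.
by have := mulr_ge0 (ltW beta_gt0) (ltW Is_gt0); have := mu_gt0; lra.
Qed.

Let coefV_gt0 : 0 < coefV.
Proof.
rewrite lt_min b_gt0 andbT mulr_gt0 //.
by have := mulr_ge0 (mulr_ge0 (ltW beta_gt0) sigma_ge0) (ltW Is_gt0); have := mu_gt0; lra.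
Qed.

Definition lyapunov t :=
  \sum_x (volterra Ss (S x t) + volterra Vs (V x t) + volterra Is (I x t)).
Definition lyapunov_rate t := \sum_x
  ((1 - Ss / S x t) * dS x t + (1 - Vs / V x t) * dV x t + (1 - Is / I x t) * dI x t).
Definition deviation t := \sum_x ((S x t - Ss) ^+ 2 + (V x t - Vs) ^+ 2).
Definition deviation_rate t :=
  \sum_x (2 * (S x t - Ss) * dS x t + 2 * (V x t - Vs) * dV x t).

Lemma dS_forcing_le t x (delta : R) :
  (forall y, `|S y t - Ss| <= delta) -> `|V x t - Vs| <= delta ->
  `|dS x t - beta * S x t * (Is - I x t)|
    <= (2 * eps * total_weight adj w + mu + p + xi + beta * Is) * delta.
Proof.
move=> Sd Vd; set k := mu + p + beta * Is.
have k0 : 0 <= k.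
  have := mulr_ge0 (ltW beta_gt0) (ltW Is_gt0).
  by have := mu_gt0; have := p_ge0; rewrite /k; lra.
have -> : dS x t - beta * S x t * (Is - I x t)
    = eps * laplacian adj w (S ^~ t) x - k * (S x t - Ss) + xi * (V x t - Vs).
  by rewrite /dS /fS aE /k; ring.
have lap : `|eps * laplacian adj w (S ^~ t) x| <= eps * (total_weight adj w * (2 * delta)).
  rewrite normrM gtr0_norm //; apply: ler_wpM2l; first exact: ltW.
  apply: norm_laplacian_le => // y.
  have := Sd y; have := Sd x; rewrite !ler_norml => /andP[? ?] /andP[? ?].
  by apply/andP; split; lra.
have Sx : `|k * (S x t - Ss)| <= k * delta by rewrite normrM ger0_norm // ler_wpM2l.
have Vx : `|xi * (V x t - Vs)| <= xi * delta by rewrite normrM ger0_norm // ler_wpM2l.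
have := ler_normD (eps * laplacian adj w (S ^~ t) x - k * (S x t - Ss)) (xi * (V x t - Vs)).
have := ler_normB (eps * laplacian adj w (S ^~ t) x) (k * (S x t - Ss)).
rewrite /k in Sx *; lra.
Qed.

Section FromPositiveTime.
Variable t0 : R.
Hypotheses (t0_gt0 : 0 < t0) (pos_t0 : positive t0).

Definition pop_bound := Num.max (population t0) (\sum_(x : T) N + 1).
Local Notation M := pop_bound.

Lemma pop_bound_gt0 : 0 < M.
Proof.
apply: lt_le_trans (_ : 0 < \sum_(x : T) N + 1) _; last by rewrite le_max lexx orbT.
by apply: ltr_wpDl; [apply: sumr_ge0 => x _; exact: ltW | exact: ltr01].
Qed.

Lemma population_le b : t0 <= b -> (forall s, t0 < s < b -> positive s) ->
  population b <= M.
Proof.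
move=> t0b pos.
have : expR (mu * t0) * (M - population t0) <= expR (mu * b) * (M - population b).
  apply: (gronwall (f := fun s => M - population s)
    (df := fun s => - \sum_x (mu * N - mu * (S x s + V x s + I x s) - gamma * I x s)) t0b).
    move=> u /andP[t0u _]; apply: is_derive_eq (is_deriveB (is_derive_cst M u 1)
      (is_derive_population (lt_le_trans t0_gt0 t0u))) _; exact: add0r.
  move=> u /pos pos_u.
  have : \sum_x (mu * N - mu * (S x u + V x u + I x u) - gamma * I x u)
      <= \sum_x (mu * N - mu * (S x u + V x u + I x u)).
    apply: ler_sum => x _; have [_ [_ I_gt0]] := pos_u x.
    by have := mulr_ge0 gamma_ge0 (ltW I_gt0); lra.
  have -> : \sum_x (mu * N - mu * (S x u + V x u + I x u))
      = mu * \sum_(x : T) N - mu * population u by rewrite sumrB -!mulr_sumr.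
  have : \sum_(x : T) N <= M by rewrite le_max lerDl ler01 orbT.
  move=> /(ler_wpM2l (ltW mu_gt0)); lra.
have : 0 <= M - population t0 by rewrite subr_ge0 le_max lexx.
move=> /(mulr_ge0 (expR_ge0 (mu * t0))) /le_trans /[apply].
by rewrite pmulr_rge0 ?expR_gt0 // subr_ge0.
Qed.

Lemma state_le_pop_bound t x : positive t -> population t <= M ->
  [/\ S x t <= M, V x t <= M & I x t <= M].
Proof.
move=> pos_t pop_t.
have : S x t + V x t + I x t <= population t.
  rewrite /population (bigD1 x) //= lerDl; apply: sumr_ge0 => y _.
  by have [? [? ?]] := pos_t y; lra.
by have [? [? ?]] := pos_t x; split; lra.
Qed.

Definition decay_rate := eps * total_weight adj w + mu + p + xi + gamma + beta * M.
Local Notation k := decay_rate.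

Lemma derivs_ge t x : positive t -> population t <= M ->
  [/\ - k * S x t <= dS x t, - k * V x t <= dV x t & - k * I x t <= dI x t].
Proof.
move=> pos_t pop_t; have [SM VM IM] := state_le_pop_bound x pos_t pop_t.
have [S_gt0 [V_gt0 I_gt0]] := pos_t x.
have lap_ge (F : T -> R) : (forall y, 0 < F y) ->
    - (eps * total_weight adj w) * F x <= eps * laplacian adj w F x.
  move=> F_gt0; rewrite mulNr -mulrA -mulrN; apply: ler_wpM2l; first exact: ltW.
  by rewrite -mulNr; apply: laplacian_ge => // y; exact/ltW.
have lS := lap_ge (S ^~ t) (fun y => (pos_t y).1).
have lV := lap_ge (V ^~ t) (fun y => (pos_t y).2.1).
have lI := lap_ge (I ^~ t) (fun y => (pos_t y).2.2).
have nn (c u : R) : 0 <= c -> 0 < u -> 0 <= c * u by move=> c0 /ltW; exact: mulr_ge0.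
have b0 := ltW beta_gt0; have M0 := ltW pop_bound_gt0.
have SI : beta * S x t * I x t <= beta * S x t * M by rewrite ler_wpM2l ?nn.
have VI : beta * sigma * V x t * I x t <= beta * V x t * M.
  have sI : sigma * I x t <= M by apply: le_trans _ IM; rewrite ler_piMl // ltW.
  have -> : beta * sigma * V x t * I x t = beta * V x t * (sigma * I x t) by ring.
  by rewrite ler_wpM2l ?nn.
have := nn _ _ (mulr_ge0 b0 M0) I_gt0; have := nn _ _ (mulr_ge0 b0 sigma_ge0) V_gt0.
have := nn _ _ b0 S_gt0; rewrite /dS /dV /dI /fS /fV /fI /k => bS bsV bMI; split.
- have := nn _ _ xi_ge0 S_gt0; have := nn _ _ gamma_ge0 S_gt0.
  by have := nn _ _ xi_ge0 V_gt0; have := a_gt0; lra.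
- have := nn _ _ p_ge0 S_gt0; have := nn _ _ p_ge0 V_gt0.
  by have := nn _ _ gamma_ge0 V_gt0; have := b_gt0; lra.
- have := nn _ _ bS I_gt0; have := nn _ _ bsV I_gt0.
  by have := nn _ _ p_ge0 I_gt0; have := nn _ _ xi_ge0 I_gt0; lra.
Qed.

Lemma positive_closed b : t0 < b -> (forall s, t0 < s < b -> positive s) -> positive b.
Proof.
move=> t0b pos x.
have bounded u : t0 < u < b -> positive u /\ population u <= M.
  move=> /andP[t0u ub]; split; first by apply: pos; rewrite t0u.
  apply: population_le (ltW t0u) _ => s /andP[t0s su].
  by apply: pos; rewrite t0s (lt_trans su ub).
have u_gt0 u : t0 <= u <= b -> 0 < u by case/andP => /(lt_le_trans t0_gt0).
have stays_gt0 (f df : R -> R) : (forall u, t0 <= u <= b -> is_derive u 1 f (df u)) ->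
    (forall u, t0 < u < b -> - k * f u <= df u) -> 0 < f t0 -> 0 < f b.
  move=> fD fdf f0; have := gronwall (ltW t0b) fD fdf.
  have : 0 < expR (k * t0) * f t0 by rewrite mulr_gt0 ?expR_gt0.
  by move=> /lt_le_trans /[apply]; rewrite pmulr_rgt0 ?expR_gt0.
have [S0 [V0 I0]] := pos_t0 x.
split; [|split];
  [apply: (stays_gt0 _ (dS x)) | apply: (stays_gt0 _ (dV x)) | apply: (stays_gt0 _ (dI x))]
  => // u.
- by move/u_gt0/(is_derive_SVI x) => [].
- by move/bounded => [pos_u /(derivs_ge x pos_u) []].
- by move/u_gt0/(is_derive_SVI x) => [].
- by move/bounded => [pos_u /(derivs_ge x pos_u) []].
- by move/u_gt0/(is_derive_SVI x) => [].
- by move/bounded => [pos_u /(derivs_ge x pos_u) []].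
Qed.

Lemma positive_ge t : t0 <= t -> positive t.
Proof.
apply: real_induction => // [b|u t0u pos_u]; first exact: positive_closed.
have cvg_at (f : R -> R) df : is_derive u 1 f df -> f s @[s --> u] --> f u.
  by case=> fd _; exact/differentiable_continuous/derivable1_diffP.
apply: (eventually_positive (F := nbhs u) (t := u)) => // x.
have [/cvg_at ? /cvg_at ? /cvg_at ?] := is_derive_SVI x (lt_le_trans t0_gt0 t0u).
by split.
Qed.

Lemma state_bounds t x : t0 <= t ->
  [/\ 0 < S x t <= M, 0 < V x t <= M & 0 < I x t <= M].
Proof.
move=> t0t; have pos_t := positive_ge t0t.
have pop_t : population t <= M.
  by apply: population_le t0t _ => s /andP[t0s _]; exact/positive_ge/ltW.
have [S0 [V0 I0]] := pos_t x; have [SM VM IM] := state_le_pop_bound x pos_t pop_t.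
by rewrite S0 V0 I0 SM VM IM.
Qed.

Definition dissipation := Num.min (coefS / (M * Ss)) (coefV / (M * Vs)).
Local Notation c := dissipation.

Lemma dissipation_gt0 : 0 < c.
Proof.
have M0 := pop_bound_gt0; have S0 := coefS_gt0; have V0 := coefV_gt0.
by rewrite lt_min; apply/andP; split; apply: divr_gt0; rewrite ?mulr_gt0.
Qed.

Lemma is_derive_lyapunov t : t0 <= t -> is_derive t 1 lyapunov (lyapunov_rate t).
Proof.
move=> t0t; apply: is_derive_sumT => x.
have [/andP[S0 _] /andP[V0 _] /andP[I0 _]] := state_bounds x t0t.
have [dSx dVx dIx] := is_derive_SVI x (lt_le_trans t0_gt0 t0t).
exact: is_deriveD (is_deriveD (is_derive_volterra Ss S0 dSx) (is_derive_volterra Vs V0 dVx))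
  (is_derive_volterra Is I0 dIx).
Qed.

Lemma lyapunov_ge t : t0 <= t ->
  \sum_(x : T) (volterra Ss Ss + volterra Vs Vs + volterra Is Is) <= lyapunov t.
Proof.
move=> t0t; apply: ler_sum => x _.
have [/andP[S0 _] /andP[V0 _] /andP[I0 _]] := state_bounds x t0t.
exact: lerD (lerD (volterra_ge Ss_gt0 S0) (volterra_ge Vs_gt0 V0)) (volterra_ge Is_gt0 I0).
Qed.

Lemma reaction_rate_le t x : t0 <= t ->
  (1 - Ss / S x t) * fS x t + (1 - Vs / V x t) * fV x t + (1 - Is / I x t) * fI x t
  <= - c * ((S x t - Ss) ^+ 2 + (V x t - Vs) ^+ 2).
Proof.
move=> t0t; have [/andP[S0 SM] /andP[V0 VM] /andP[I0 _]] := state_bounds x t0t.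
apply: le_trans (reaction_lyapunov_le S0 V0 I0 Ss_gt0 Vs_gt0 Is_gt0 p_ge0 xi_ge0
  aE bE gammaE) _.
have cS : c * (S x t - Ss) ^+ 2 <= coefS * ((S x t - Ss) ^+ 2 / (S x t * Ss)).
  apply: (ler_mul_ratio (ltW coefS_gt0) (sqr_ge0 _) S0 SM Ss_gt0).
  by rewrite ge_min lexx.
have cV : c * (V x t - Vs) ^+ 2 <= coefV * ((V x t - Vs) ^+ 2 / (V x t * Vs)).
  apply: (ler_mul_ratio (ltW coefV_gt0) (sqr_ge0 _) V0 VM Vs_gt0).
  by rewrite ge_min lexx orbT.
rewrite -/coefS -/coefV; lra.
Qed.

Lemma lyapunov_rate_le t : t0 <= t -> lyapunov_rate t <= - c * deviation t.
Proof.
move=> t0t.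
have lap_le0 (F : T -> R) (Fs : R) : 0 < Fs -> (forall y, 0 < F y) ->
    eps * \sum_x (1 - Fs / F x) * laplacian adj w F x <= 0.
  move=> Fs0 F0; rewrite pmulr_rle0 //; exact: laplacian_volterra_le0 (ltW Fs0) F0.
have posS y : 0 < S y t by case: (state_bounds y t0t) => /andP[].
have posV y : 0 < V y t by case: (state_bounds y t0t) => _ /andP[].
have posI y : 0 < I y t by case: (state_bounds y t0t) => _ _ /andP[].
have -> : lyapunov_rate t =
    eps * \sum_x (1 - Ss / S x t) * laplacian adj w (S ^~ t) x
  + eps * \sum_x (1 - Vs / V x t) * laplacian adj w (V ^~ t) x
  + eps * \sum_x (1 - Is / I x t) * laplacian adj w (I ^~ t) x
  + \sum_x ((1 - Ss / S x t) * fS x t + (1 - Vs / V x t) * fV x t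
            + (1 - Is / I x t) * fI x t).
  rewrite /lyapunov_rate !mulr_sumr -!big_split /=; apply: eq_bigr => x _.
  by rewrite /dS /dV /dI; ring.
have : \sum_x ((1 - Ss / S x t) * fS x t + (1 - Vs / V x t) * fV x t
                + (1 - Is / I x t) * fI x t) <= - c * deviation t.
  by rewrite /deviation mulr_sumr; apply: ler_sum => x _; exact: reaction_rate_le.
have := lap_le0 _ _ Ss_gt0 posS; have := lap_le0 _ _ Vs_gt0 posV.
have := lap_le0 _ _ Is_gt0 posI; lra.
Qed.

Definition deriv_bound := eps * (total_weight adj w * M)
  + (mu * N + (mu + p + xi + gamma) * M + 2 * beta * M * M).
Local Notation K := deriv_bound.

Lemma norm_derivs_le t x : t0 <= t ->
  [/\ `|dS x t| <= K, `|dV x t| <= K & `|dI x t| <= K].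
Proof.
move=> t0t; have [Sb Vb Ib] := state_bounds x t0t.
have r01 : 0 <= r <= 1 by rewrite !ltW.
have := norm_reactions_le Sb Vb Ib (ltW mu_gt0) p_ge0 xi_ge0 gamma_ge0 (ltW beta_gt0)
  (introT andP (conj sigma_ge0 sigma_le1)) r01 (ltW N_gt0).
move=> /= [fSb fVb fIb].
have lap_le (F : T -> R) : (forall y, 0 < F y <= M) ->
    `|eps * laplacian adj w F x| <= eps * (total_weight adj w * M).
  move=> FM; rewrite normrM gtr0_norm //; apply: ler_wpM2l; first exact: ltW.
  apply: norm_laplacian_le => // y; have /andP[? ?] := FM y; have /andP[? ?] := FM x.
  by rewrite ler_norml; apply/andP; split; lra.
have bounds y : [/\ 0 < S y t <= M, 0 < V y t <= M & 0 < I y t <= M].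
  exact: state_bounds.
by split; apply: le_trans (ler_normD _ _) _; apply: lerD => //; apply: lap_le => y;
  case: (bounds y).
Qed.

Lemma deriv_bound_ge0 : 0 <= K.
Proof.
have M0 := ltW pop_bound_gt0.
have := mulr_ge0 (ltW eps_gt0) (mulr_ge0 (total_weight_ge0 w_gt0) M0).
have := mulr_ge0 (ltW mu_gt0) (ltW N_gt0).
have := mulr_ge0 (mulr_ge0 (ltW beta_gt0) M0) M0.
have : 0 <= (mu + p + xi + gamma) * M by rewrite mulr_ge0 // !addr_ge0 // ltW.
rewrite /deriv_bound; lra.
Qed.

Definition deviation_bound := \sum_(x : T) (2 * (M + Ss) * K + 2 * (M + Vs) * K) + 1.
Local Notation L := deviation_bound.

Lemma deviation_bound_gt0 : 0 < L.
Proof.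
have M0 := ltW pop_bound_gt0; have K0 := deriv_bound_ge0.
suff : 0 <= \sum_(x : T) (2 * (M + Ss) * K + 2 * (M + Vs) * K) by rewrite /L; lra.
apply: sumr_ge0 => x _; have := Ss_gt0; have := Vs_gt0 => ? ?.
by rewrite addr_ge0 // !mulr_ge0 //; lra.
Qed.

Lemma is_derive_deviation t : t0 <= t -> is_derive t 1 deviation (deviation_rate t).
Proof.
move=> t0t; apply: is_derive_sumT => x.
have [dSx dVx _] := is_derive_SVI x (lt_le_trans t0_gt0 t0t).
exact: is_deriveD (is_derive_sqrB Ss dSx) (is_derive_sqrB Vs dVx).
Qed.

Lemma deviation_rate_ge t : t0 <= t -> - L <= deviation_rate t.
Proof.
move=> t0t.
have prod_ge (a b A B : R) : `|a| <= A -> `|b| <= B -> - (A * B) <= a * b.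
  move=> aA bB; have : `|a * b| <= A * B by rewrite normrM ler_pM.
  by rewrite ler_norml => /andP[].
suff : - (L - 1) <= deviation_rate t by lra.
rewrite /deviation_rate addrK -sumrN; apply: ler_sum => x _.
have [/andP[S0 SM] /andP[V0 VM] _] := state_bounds x t0t.
have [dSb dVb _] := norm_derivs_le x t0t.
have SSs : `|2 * (S x t - Ss)| <= 2 * (M + Ss).
  by rewrite ler_norml; apply/andP; split; have := Ss_gt0; lra.
have VVs : `|2 * (V x t - Vs)| <= 2 * (M + Vs).
  by rewrite ler_norml; apply/andP; split; have := Vs_gt0; lra.
have := prod_ge _ _ _ _ SSs dSb; have := prod_ge _ _ _ _ VVs dVb; lra.
Qed.

Lemma deviation_cvg e : 0 < e -> exists T, forall t, T <= t -> deviation t < e.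
Proof.
have dev_ge0 t : t0 <= t -> 0 <= deviation t.
  by move=> _; apply: sumr_ge0 => x _; rewrite addr_ge0 ?sqr_ge0.
exact: (dissipation_cvg dissipation_gt0 deviation_bound_gt0 is_derive_lyapunov
  is_derive_deviation dev_ge0 lyapunov_rate_le deviation_rate_ge lyapunov_ge).
Qed.

Lemma SV_near e : 0 < e -> exists t1, forall t, t1 <= t -> forall x,
  `|S x t - Ss| < e /\ `|V x t - Vs| < e.
Proof.
move=> e0; have [t1 devT] := deviation_cvg (mulr_gt0 e0 e0).
exists t1 => t t1t x; have := devT t t1t.
have : (S x t - Ss) ^+ 2 + (V x t - Vs) ^+ 2 <= deviation t.
  rewrite /deviation (bigD1 x) //= lerDl.
  by apply: sumr_ge0 => y _; rewrite addr_ge0 ?sqr_ge0.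
have := sqr_ge0 (S x t - Ss); have := sqr_ge0 (V x t - Vs).
by rewrite -expr2 => *; split; apply: norm_lt_sqr => //; lra.
Qed.

Lemma I_cvg : unif_cvg I Is.
Proof.
move=> e e0.
have a0_gt0 : 0 < beta * Ss / 2 by rewrite divr_gt0 ?mulr_gt0.
have [rho rho0 forced] := forcing_cvg a0_gt0 deriv_bound_ge0 e0.
set C := 2 * eps * total_weight adj w + mu + p + xi + beta * Is.
have C0 : 0 <= C.
  have := mulr_ge0 (ltW eps_gt0) (total_weight_ge0 w_gt0).
  have := mulr_ge0 (ltW beta_gt0) (ltW Is_gt0).
  by have := mu_gt0; have := p_ge0; have := xi_ge0; rewrite /C; lra.
set delta := Num.min (Ss / 2) (Num.min rho (rho / (C + 1))).
have delta0 : 0 < delta by rewrite !lt_min rho0 !divr_gt0 //; lra.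
have [d1 d2 d3] : [/\ delta <= Ss / 2, delta <= rho & delta <= rho / (C + 1)].
  by rewrite !ge_min !lexx !orbT.
have [t1 near_t1] := SV_near delta0.
exists (Num.max t0 t1) => t t0t1t x.
apply: (forced (S x) (I x) (dS x) (dI x) (fun u => beta * S x u) Ss Is (Num.max t0 t1))
  => // u; rewrite ge_max => /andP[t0u t1u]; have [Sx Vx] := near_t1 u t1u x.
- by have [] := is_derive_SVI x (lt_le_trans t0_gt0 t0u).
- by have [] := is_derive_SVI x (lt_le_trans t0_gt0 t0u).
- by have [] := norm_derivs_le x t0u.
- rewrite -mulrA ler_wpM2l ?ltW //.
  by move: Sx; rewrite ltr_norml => /andP[? ?]; lra.
- exact: lt_le_trans Sx d2.
- apply: le_trans (dS_forcing_le (fun y => ltW (near_t1 u t1u y).1) (ltW Vx)) _.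
  have C1 : 0 < C + 1 by lra.
  rewrite -/C; apply: le_trans (_ : (C + 1) * delta <= rho).
    by apply: ler_wpM2r; [exact: ltW | lra].
  by apply: le_trans (ler_wpM2l (ltW C1) d3) _; rewrite mulrC divfK ?gt_eqF.
Qed.

End FromPositiveTime.

Lemma SVIRS_cvg : [/\ unif_cvg S Ss, unif_cvg V Vs & unif_cvg I Is].
Proof.
have [t0 t0_gt0 pos_t0] := positive_after0.
have SV := SV_near t0_gt0 pos_t0.
split; last exact: I_cvg t0_gt0 pos_t0.
- by move=> e /SV[t1 near_t1]; exists t1 => t t1t x; have [] := near_t1 t t1t x.
- by move=> e /SV[t1 near_t1]; exists t1 => t t1t x; have [] := near_t1 t t1t x.
Qed.

End SVIRS.

Theorem theorem1 (R : realType) (T : finType) (adj : rel T) (w : T -> T -> R)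
  (N r mu p beta sigma xi gamma eps : R) (Ss Vs Is : R) :
  weighted_graph adj w ->
  0 < N -> 0 < r -> r < 1 -> 0 < mu -> 0 < beta ->
  0 <= p -> p <= 1 -> 0 <= sigma -> sigma <= 1 -> 0 < eps -> eps <= 1 ->
  0 <= xi -> 0 <= gamma ->
  1 < R0 N r mu p beta sigma xi gamma ->
  endemic_equilibrium N r mu p beta sigma xi 0 gamma Ss Vs Is ->
  forall S V I : T -> R -> R,
    SVIRS_solution adj w N r mu p beta sigma xi 0 gamma eps S V I ->
    (forall x, 0 < S x 0 /\ 0 < V x 0 /\ 0 < I x 0) ->
    [/\ unif_cvg S Ss, unif_cvg V Vs & unif_cvg I Is].
Proof.
move=> graph N_gt0 r_gt0 r_lt1 mu_gt0 beta_gt0 p_ge0 _ sigma_ge0 sigma_le1 eps_gt0 _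
  xi_ge0 gamma_ge0 _ equilibrium S V I solution init_pos.
exact: (SVIRS_cvg graph N_gt0 r_gt0 r_lt1 mu_gt0 beta_gt0 p_ge0 sigma_ge0 sigma_le1
  eps_gt0 xi_ge0 gamma_ge0 equilibrium solution init_pos).
Qed.
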